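(* Let $N\in\{2,3\}$ and $\beta\in\mathbb{R}$, and consider the problem $$-\Delta u=u^3+\beta uv^2\ \text{ in }\mathbb{R}^N,\qquad -\Delta v=v^3+\beta u^2v\ \text{ in }\mathbb{R}^N,\qquad u,v\in C_b^2(\mathbb{R}^N)\text{ and }u,v\text{ are radial}.$$ If $\beta\neq-1$ and if $n(u+v),n(u-v)<\infty$, then the problem admits no nontrivial solutions $(u,v)$. If $\beta=-1$ and if $n(u+v),n(u-v)<\infty$, then any solution $(u,v)$ of the problem is of the form $(c,-c)$ for some constant $c\in\mathbb{R}$.
   Context: $C_b^2(\mathbb{R}^N)$ denotes the $C^2$ functions on $\mathbb{R}^N$ that are bounded together with their derivatives up to order two. Nodal number: for a continuous radial function $u:\mathbb{R}^N\to\mathbb{R}$, $n(u)\in\mathbb{N}\cup\{\infty\}$ is the maximum (or $\infty$ if no maximum exists) nonnegative integer $m$ such that there are $0<x_0<x_1<\cdots<x_m$ with $u|_{|x|=x_{j-1}}\cdot u|_{|x|=x_j}<0$ for $j=1,\dots,m$.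
   Formalization: For β = −1 the conclusion is corrected to ''(c,−c) or (c,c)'', since every constant pair (c,c) with c ≠ 0 also solves the problem with n(u+v) = n(u−v) = 0 and is not of the form (c,−c). *)

(* Defs.v *)
From HB Require Import structures.
From mathcomp Require Import all_boot all_order all_algebra.
From mathcomp Require Import all_classical all_reals all_analysis.
Import Order.TTheory GRing.Theory Num.Theory.
Import numFieldNormedType.Exports.

Set Implicit Arguments.
Unset Strict Implicit.
Unset Printing Implicit Defensive.

Local Open Scope classical_set_scope.
Local Open Scope ring_scope.

(* The library norm on 'rV[R]_N is the max norm, hence this definition; both
   norms induce the same topology, so [continuous] needs no adjustment. *)
Definition eucl_norm (R : realType) (N : nat) (x : 'rV[R]_N) : R :=
  Num.sqrt (\sum_(i < N) x ord0 i ^+ 2).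

Definition radial (R : realType) (N : nat) (u : 'rV[R]_N -> R) : Prop :=
  forall x y : 'rV[R]_N, eucl_norm x = eucl_norm y -> u x = u y.

Definition partial (R : realType) (N : nat) (i : 'I_N) (u : 'rV[R]_N -> R) :
    'rV[R]_N -> R :=
  'D_(delta_mx ord0 i) u.

(* [derive] is total, so existence of the partial derivatives is a separate
   requirement. *)
Definition partially_derivable (R : realType) (N : nat) (u : 'rV[R]_N -> R) :
    Prop :=
  forall (i : 'I_N) (x : 'rV[R]_N), derivable u x (delta_mx ord0 i).

Definition C2b (R : realType) (N : nat) (u : 'rV[R]_N -> R) : Prop :=
  [/\ continuous u /\ bounded_fun u,
      partially_derivable u,
      forall i : 'I_N, continuous (partial i u) /\ bounded_fun (partial i u),
      forall i : 'I_N, partially_derivable (partial i u)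
    & forall i j : 'I_N, continuous (partial j (partial i u)) /\
                         bounded_fun (partial j (partial i u))].

Definition laplacian (R : realType) (N : nat) (u : 'rV[R]_N -> R)
    (x : 'rV[R]_N) : R :=
  \sum_(i < N) partial i (partial i u) x.

Definition solution (R : realType) (N : nat) (beta : R)
    (u v : 'rV[R]_N -> R) : Prop :=
  [/\ C2b u /\ C2b v,
      radial u /\ radial v,
      forall x, - laplacian u x = u x ^+ 3 + beta * u x * v x ^+ 2
    & forall x, - laplacian v x = v x ^+ 3 + beta * u x ^+ 2 * v x].

(* u changes sign along some radii 0 < r 0 < ... < r m; only these values of
   the sequence r matter. For radial u and N > 0, quantifying over all points
   of the two spheres expresses the sign of the product of the two values. *)
Definition alternates (R : realType) (N : nat) (u : 'rV[R]_N -> R)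
    (m : nat) : Prop :=
  exists r : nat -> R,
    [/\ 0 < r 0%N,
        forall j : nat, (j < m)%N -> r j < r j.+1
      & forall j : nat, (j < m)%N -> forall y z : 'rV[R]_N,
          eucl_norm y = r j -> eucl_norm z = r j.+1 -> u y * u z < 0].

Definition is_max_alternates (R : realType) (N : nat) (u : 'rV[R]_N -> R)
    (m : nat) : Prop :=
  alternates u m /\ forall k : nat, alternates u k -> (k <= m)%N.

(* Values in N together with infinity, encoded as [None]. *)
Definition nodal_number (R : realType) (N : nat) (u : 'rV[R]_N -> R) :
    option nat :=
  if pselect (exists m : nat, is_max_alternates u m) is left h
  then Some (projT1 (cid h)) else None.

Definition finite_nodal_number (R : realType) (N : nat) (u : 'rV[R]_N -> R) :
    Prop :=
  nodal_number u <> None.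

(* Main.v *)
Require Import Defs.
From mathcomp Require Import all_boot all_order all_algebra.
From mathcomp Require Import all_classical all_reals all_analysis.
From mathcomp Require Import ring lra.
Import Order.TTheory GRing.Theory Num.Theory.
Import numFieldNormedType.Exports.

(** The rotation w = u + v, z = u - v turns the system into
      - Delta w = w (a w^2 + b z^2),   - Delta z = z (a z^2 + b w^2)
    with a = (1 + beta) / 4 and b = (3 - beta) / 4. The coefficients change
    sign with beta, but a + b = 1 always holds, and this is what drives the
    argument. Finiteness of the nodal numbers says that w and z keep a sign
    far out, and by uniqueness for the radial equation each of them is either
    identically zero or without zeros far out.

    Suppose that neither w nor z vanishes far out. The geometric mean
    s = sqrt |w z| then satisfies, for every beta,
      - Delta s >= (a + b) (w^2 + z^2) s / 2 >= s^3,
    because the gradient terms have a good sign (the geometric mean is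
    concave) and the quadratic forms a w^2 + b z^2 and a z^2 + b w^2 add up to
    w^2 + z^2 ([no_signed_pair]). In dimensions two and three a positive
    radial function cannot satisfy this in the exterior of a ball
    ([exterior_liouville]). Hence w or z is identically zero
    ([one_component_vanishes]).

    The other component solves the scalar equation - Delta w = a w^3 on the
    whole space, where only the sign of a matters ([remaining_component]):
      a > 0: the same exterior Liouville property gives w = 0;
      a = 0: w is harmonic and radial, hence constant;
      a < 0: w^2 is nondecreasing in the radius, and unbounded unless w = 0.
    As a = 0 means beta = -1, the constant pairs (c, c) and (c, -c) survive
    exactly in that case. *)

Set Implicit Arguments.
Unset Strict Implicit.
Unset Printing Implicit Defensive.
Local Open Scope ring_scope.

(** * Derivatives of functions of one real variable *)

Section Calculus.
Context {R : realType}.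

(** Not a type class, unlike [is_derive]: the rules below are applied to goals
    whose derivative is still to be computed, and instance resolution would
    fill it in prematurely. *)
Definition has_deriv (f : R -> R) (x a : R) : Prop := is_derive x 1 f a.

Implicit Types (f g : R -> R) (a b x : R).

Lemma has_deriv_cst x (c : R) : has_deriv (fun _ : R => c) x 0.
Proof. exact: is_derive_cst. Qed.

Lemma has_deriv_id x : has_deriv (fun y : R => y) x 1.
Proof. exact: is_derive_id. Qed.

Lemma has_deriv_add f g x a b : has_deriv f x a -> has_deriv g x b ->
  has_deriv (fun y => f y + g y) x (a + b).
Proof. by move=> ? ?; exact: is_deriveD. Qed.

Lemma has_deriv_opp f x a : has_deriv f x a ->
  has_deriv (fun y => - f y) x (- a).
Proof. by move=> ?; exact: is_deriveN. Qed.

Lemma has_deriv_mul f g x a b : has_deriv f x a -> has_deriv g x b ->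
  has_deriv (fun y => f y * g y) x (a * g x + f x * b).
Proof.
move=> fa gb; have := is_deriveM fa gb.
rewrite (_ : f * g = (fun y => f y * g y))//.
move=> D; apply: (is_derive_eq D).
by rewrite /GRing.scale /= addrC mulrC.
Qed.

Lemma has_deriv_exp f n x a : has_deriv f x a ->
  has_deriv (fun y => f y ^+ n) x (n%:R * f x ^+ n.-1 * a).
Proof.
move=> fa; have -> : (fun y => f y ^+ n) = f ^+ n.
  by apply/funext => y; rewrite exprfctE.
exact: is_deriveX.
Qed.

Lemma has_deriv_chain f g x a b : has_deriv g x b -> has_deriv f (g x) a ->
  has_deriv (fun y => f (g y)) x (a * b).
Proof. by move=> ? ?; exact: is_derive1_comp. Qed.

Lemma has_deriv_inv f x a : f x != 0 -> has_deriv f x a ->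
  has_deriv (fun y => (f y)^-1) x (- (f x) ^- 2 * a).
Proof. by move=> ? ?; exact: is_deriveV. Qed.

Lemma has_deriv_ln f x a : 0 < f x -> has_deriv f x a ->
  has_deriv (fun y => ln (f y)) x ((f x)^-1 * a).
Proof. by move=> fx0 fa; apply: has_deriv_chain fa _; exact: is_derive1_ln. Qed.

Lemma has_deriv_expR f x a : has_deriv f x a ->
  has_deriv (fun y => expR (f y)) x (expR (f x) * a).
Proof. by move=> fa; apply: has_deriv_chain fa _; exact: is_derive_expR. Qed.

Lemma has_deriv_sqrt f x a : 0 < f x -> has_deriv f x a ->
  has_deriv (fun y => Num.sqrt (f y)) x ((2 * Num.sqrt (f x))^-1 * a).
Proof. by move=> fx0 fa; apply: has_deriv_chain fa _; exact: is_derive1_sqrt. Qed.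

Lemma has_deriv_eq f x a b : has_deriv f x a -> a = b -> has_deriv f x b.
Proof. by move=> ? <-. Qed.

End Calculus.

(** Differentiates an explicit expression by its syntax. The premises that
    divisors are nonzero and that arguments of [ln] and [Num.sqrt] are positive
    are left to the user. *)
Ltac derive_rules :=
  lazymatch goal with
  | |- has_deriv (fun x => @?f x + @?g x) _ _ =>
      apply: (@has_deriv_add _ f g); derive_rules
  | |- has_deriv (fun x => @?f x * @?g x) _ _ =>
      apply: (@has_deriv_mul _ f g); derive_rules
  | |- has_deriv (fun x => - @?f x) _ _ =>
      apply: (@has_deriv_opp _ f); derive_rules
  | |- has_deriv (fun x => (@?f x) ^+ ?n) _ _ =>
      apply: (@has_deriv_exp _ f n); derive_rules
  | |- has_deriv (fun x => (@?f x) ^-1) _ _ =>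
      apply: (@has_deriv_inv _ f); [idtac | derive_rules]
  | |- has_deriv (fun x => ln (@?f x)) _ _ =>
      apply: (@has_deriv_ln _ f); [idtac | derive_rules]
  | |- has_deriv (fun x => expR (@?f x)) _ _ =>
      apply: (@has_deriv_expR _ f); derive_rules
  | |- has_deriv (fun x => Num.sqrt (@?f x)) _ _ =>
      apply: (@has_deriv_sqrt _ f); [idtac | derive_rules]
  | |- has_deriv (fun x => x) _ _ => exact: has_deriv_id
  | |- _ => first [eassumption | exact: has_deriv_cst | idtac]
  end.

(** Also leaves the equation between the computed and the stated derivative. *)
Ltac differentiate := apply: has_deriv_eq; [derive_rules | ]; cbv beta.

Section Monotonicity.
Context {R : realType}.
Implicit Types (f df : R -> R) (a b : R).

Lemma derive_le0_le f df a b : a <= b ->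
  (forall x, a <= x <= b -> has_deriv f x (df x)) ->
  (forall x, a < x < b -> df x <= 0) -> f b <= f a.
Proof.
move=> ab fdf df0; have [->//|nab] := eqVneq a b.
have ltab : a < b by rewrite lt_neqAle nab.
have [||d dab E] := @MVT R f df a b ltab.
- by move=> x /[!in_itv]/= /andP[ax xb]; apply: fdf; rewrite !ltW.
- apply: derivable_within_continuous => x /[!in_itv]/= xab.
  by case: (fdf x xab).
have : df d * (b - a) <= 0.
  by rewrite mulr_le0_ge0 ?subr_ge0//; apply: df0; move: dab; rewrite in_itv.
lra.
Qed.

Lemma derive_ge0_le f df a b : a <= b ->
  (forall x, a <= x <= b -> has_deriv f x (df x)) ->
  (forall x, a < x < b -> 0 <= df x) -> f a <= f b.
Proof.
move=> ab fdf df0; rewrite -lerN2.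
apply: (@derive_le0_le (fun x => - f x) (fun x => - df x)) => // x xab.
  by apply: has_deriv_opp; exact: fdf.
by rewrite oppr_le0 df0.
Qed.

Lemma derive_eq0_eq f df a b : a <= b ->
  (forall x, a <= x <= b -> has_deriv f x (df x)) ->
  (forall x, a < x < b -> df x = 0) -> f a = f b.
Proof.
move=> ab fdf df0; apply/eqP; rewrite eq_le.
rewrite (derive_ge0_le ab fdf) ?(derive_le0_le ab fdf) => // x /df0 ->//.
Qed.

(** f x + m ln x is nonincreasing. A derivative below a negative constant
    satisfies the hypothesis too, with m multiplied by a, so that this one
    criterion yields all the divergence statements below. *)
Lemma log_drift f df a (m : R) : 0 < a -> 0 < m ->
  (forall x, a <= x -> has_deriv f x (df x)) ->
  (forall x, a <= x -> df x <= - (m / x)) ->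
  forall M, exists2 x, a <= x & f x < M.
Proof.
move=> a0 m0 fdf dfm M.
pose T := Num.max (ln a) (ln a + (f a - M + 1) / m).
have T1 : ln a <= T by rewrite le_max lexx.
have T2 : f a - M + 1 <= m * (T - ln a).
  by rewrite mulrC -ler_pdivrMr// lerBrDl le_max lexx orbT.
have ax : a <= expR T by rewrite -{1}[a]lnK// ler_expR.
exists (expR T) => //.
suff : f (expR T) + m * ln (expR T) <= f a + m * ln a by rewrite expRK; lra.
apply: (@derive_le0_le (fun x => f x + m * ln x) (fun x => df x + m / x)) => //.
- move=> x /andP[lax _]; have x0 : 0 < x by exact: lt_le_trans lax.
  have Df := fdf _ lax.
  by differentiate => //; rewrite mul0r add0r mulr1.
- move=> x /andP[lax _]; have := dfm x (ltW lax); lra.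
Qed.

End Monotonicity.

(** * Positive radial supersolutions outside a ball *)

Section Liouville.
Context {R : realType}.

Lemma has_deriv_pow (n : nat) (x : R) : 0 < x ->
  has_deriv (fun y => y ^+ n) x (n%:R / x * x ^+ n).
Proof.
move=> x0; differentiate; case: n => [|n]; first by rewrite !mul0r.
by rewrite /= exprS; field; rewrite gt_eqF.
Qed.

(** S'' <= - c S^3 / r^2 has no positive solution near infinity. Such an S is
    concave, hence nondecreasing, so that (r S' - S)' = r S'' <= - const / r
    forces S to tend to infinity. The inequality then dominates
    S'' <= - 2 S / r^2, whose constant exceeds the critical value 1/4 of the
    Euler equation: the nonnegative quotient r S' / S would decrease at least
    like - ln r. *)
Lemma emden_fowler_no_positive (c r1 : R) (S S1 S2 : R -> R) :
  0 < c -> 0 < r1 ->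
  (forall r, r1 <= r -> 0 < S r) ->
  (forall r, r1 <= r -> has_deriv S r (S1 r)) ->
  (forall r, r1 <= r -> has_deriv S1 r (S2 r)) ->
  (forall r, r1 <= r -> r * S2 r <= - (c * S r ^+ 3 / r)) ->
  False.
Proof.
move=> c0 r10 S_gt0 DS DS1 S2le.
have S2_le0 r : r1 <= r -> S2 r <= 0.
  move=> r1r; have r_gt0 : 0 < r by exact: lt_le_trans r1r.
  rewrite -(pmulr_rle0 _ r_gt0); apply: le_trans (S2le r r1r) _.
  rewrite oppr_le0; apply: divr_ge0; last exact: ltW.
  by apply: mulr_ge0; [exact: ltW | apply: exprn_ge0; rewrite ltW ?S_gt0].
have S1_ge0 r : r1 <= r -> 0 <= S1 r.
  move=> r1r; rewrite leNgt; apply/negP => S1r.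
  have r_gt0 : 0 < r by exact: lt_le_trans r1r.
  have [||||x rx] := @log_drift _ S S1 r (- S1 r * r) _ _ _ _ 0.
  - by [].
  - by rewrite mulr_gt0// oppr_gt0.
  - by move=> x rx; apply: DS; exact: le_trans rx.
  - move=> x rx; have x0 : 0 < x by exact: lt_le_trans rx.
    have : S1 x <= S1 r.
      apply: (@derive_le0_le _ S1 S2) => // y /andP[ry _].
        by apply: DS1; exact: le_trans ry.
      by apply: S2_le0; apply: le_trans r1r _; exact: ltW.
    move=> h; apply: le_trans h _.
    rewrite mulNr mulNr opprK ler_pdivlMr//.
    by apply: ler_wnM2l => //; exact: ltW.
  - by rewrite ltNge ltW// S_gt0// (le_trans r1r).
have S_nd x y : r1 <= x -> x <= y -> S x <= S y.
  move=> r1x xy; apply: (@derive_ge0_le _ S S1) => // z /andP[xz _].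
    by apply: DS; exact: le_trans xz.
  by apply: S1_ge0; apply: le_trans r1x _; exact: ltW.
(* 2 is a convenient constant above 1 + 1/4, which the last step needs. *)
have [r2 r1r2 cS2] : exists2 r2, r1 <= r2 & forall r, r2 <= r -> 2 <= c * S r ^+ 2.
  (* S >= M >= 1 gives c S^2 >= c M >= 2. *)
  pose M := 1 + 2 / c.
  have M1 : 1 <= M by rewrite lerDl divr_ge0// ltW.
  have [|||| r2 r1r2 S_lt] := @log_drift _ (fun r => r * S1 r - S r)
    (fun r => r * S2 r) r1 (c * S r1 ^+ 3) _ _ _ _ (- M).
  - by [].
  - by rewrite mulr_gt0// exprn_gt0// S_gt0.
  - move=> x r1x; have D := DS x r1x; have D1 := DS1 x r1x.
    by differentiate; ring.
  - move=> x r1x; have x0 : 0 < x by exact: lt_le_trans r1x.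
    apply: le_trans (S2le x r1x) _; rewrite lerN2 ler_pM2r ?invr_gt0//.
    have SS := S_nd _ _ (lexx r1) r1x.
    by rewrite ler_pM2l// lerXn2r// nnegrE ltW// S_gt0.
  exists r2 => // r r2r.
  have SM : M <= S r.
    apply: le_trans (S_nd _ _ r1r2 r2r).
    have : 0 <= r2 * S1 r2 by rewrite mulr_ge0 ?S1_ge0// (le_trans (ltW r10)).
    lra.
  have : M <= S r ^+ 2.
    have M0 : 0 <= M by apply: le_trans M1.
    by rewrite -[M]mulr1 expr2; apply: ler_pM => //; exact: le_trans SM.
  rewrite -(ler_pM2l c0); apply: le_trans.
  by rewrite /M mulrDr mulr1 mulrC divfK ?gt_eqF// lerDr ltW.
have [||||r r2r] := @log_drift _ (fun r => r * (S1 r / S r))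
    (fun r => S1 r / S r + r * S2 r / S r - r * (S1 r / S r) ^+ 2) r2 1 _ _ _ _ 0.
- exact: lt_le_trans r1r2.
- by [].
- move=> x r2x; have r1x := le_trans r1r2 r2x.
  have D := DS x r1x; have D1 := DS1 x r1x.
  have Sx := S_gt0 x r1x.
  differentiate; first by rewrite gt_eqF.
  by field; rewrite gt_eqF.
- move=> x r2x; have r1x := le_trans r1r2 r2x.
  have x0 : 0 < x by exact: lt_le_trans r1x.
  have Sx := S_gt0 x r1x.
  have H1 := S2le x r1x; have H2 := cS2 x r2x.
  have {}H1 : x * S2 x / S x <= - (2 / x).
    rewrite ler_pdivrMr//; apply: le_trans H1 _.
    rewrite (_ : c * S x ^+ 3 / x = c * S x ^+ 2 / x * S x); last by ring.
    by rewrite mulNr lerN2 ler_pM2r// ler_pM2r ?invr_gt0.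
  set q := S1 x / S x.
  have H4 : q - x * q ^+ 2 <= 1 / x.
    rewrite ler_pdivlMr//; have := sqr_ge0 (q * x - 1); nra.
  rewrite (_ : 2 / x = 1 / x + 1 / x) in H1; last by field; rewrite gt_eqF.
  rewrite -/q; lra.
- have r1r := le_trans r1r2 r2r.
  rewrite ltNge mulr_ge0//; first exact: le_trans (ltW r10) r1r.
  by apply: divr_ge0; [exact: S1_ge0 | rewrite ltW// S_gt0].
Qed.

(** The friction coefficient n is the dimension minus one. A supersolution
    must start to decrease somewhere, and then decreases for ever because
    r^n s' is nonincreasing. For a decreasing s, more friction only strengthens
    the inequality, so that dimension two reduces to dimension three, where
    r s(r) satisfies [emden_fowler_no_positive]. *)
Lemma exterior_liouville (n : nat) (c r0 : R) (s s1 s2 : R -> R) :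
  (n <= 2)%N -> 0 < c -> 0 < r0 ->
  (forall r, r0 < r -> 0 < s r) ->
  (forall r, r0 < r -> has_deriv s r (s1 r)) ->
  (forall r, r0 < r -> has_deriv s1 r (s2 r)) ->
  (forall r, r0 < r -> s2 r <= - (n%:R / r * s1 r) - c * s r ^+ 3) ->
  False.
Proof.
move=> n2 c0 r00 s_gt0 Ds Ds1 s2le.
have [r1 r1r0 s1r1] : exists2 r, r0 < r & s1 r < 0.
  (* Otherwise s is nondecreasing, hence bounded below by s a > 0, and s1
     drifts to minus infinity. *)
  apply: contrapT => noneg.
  have s1ge0 r : r0 < r -> 0 <= s1 r.
    by move=> rr0; rewrite leNgt; apply/negP => ?; apply: noneg; exists r.
  pose a := r0 + 1; have ar0 : r0 < a by rewrite /a; lra.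
  have a0 : 0 < a by exact: lt_trans ar0.
  have m0 := s_gt0 _ ar0.
  have [|||x ax s1x] := @log_drift _ s1 s2 a (c * s a ^+ 3 * a) a0 _ _ _ 0.
  - by rewrite !mulr_gt0 ?exprn_gt0.
  - by move=> x ax; apply: Ds1; exact: lt_le_trans ax.
  - move=> x ax; have xr0 : r0 < x by exact: lt_le_trans ax.
    have x0 : 0 < x by exact: lt_trans xr0.
    apply: le_trans (s2le x xr0) _.
    have nx : 0 <= n%:R / x * s1 x.
      by rewrite mulr_ge0 ?s1ge0// divr_ge0// ltW.
    have sax : s a <= s x.
      apply: (@derive_ge0_le _ s s1) => // y /andP[ay yx].
        by apply: Ds; exact: lt_le_trans ay.
      by apply: s1ge0; exact: lt_trans ay.
    have sm : s a ^+ 3 <= s x ^+ 3 by rewrite lerXn2r// nnegrE ltW// s_gt0.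
    have : c * s a ^+ 3 * a / x <= c * s x ^+ 3.
      rewrite ler_pdivrMr//; apply: ler_pM => //; first by rewrite mulr_ge0 ?ltW// exprn_gt0.
        exact: ltW.
      by rewrite ler_pM2l.
    lra.
  - by have := s1ge0 x (lt_le_trans ar0 ax); rewrite leNgt s1x.
have r10 : 0 < r1 by exact: lt_trans r1r0.
have s1_lt0 r : r1 <= r -> s1 r < 0.
  move=> r1r; have r_gt0 : 0 < r by exact: lt_le_trans r1r.
  have : s1 r * r ^+ n <= s1 r1 * r1 ^+ n.
    apply: (@derive_le0_le _ (fun x => s1 x * x ^+ n)
      (fun x => (s2 x + n%:R / x * s1 x) * x ^+ n)) => // x /andP[lx _].
      have x0 : 0 < x by exact: lt_le_trans lx.
      have D2 := Ds1 x (lt_le_trans r1r0 lx).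
      have Dn := @has_deriv_pow n x x0.
      apply: has_deriv_eq; first exact: has_deriv_mul D2 Dn.
      by rewrite mulrDl mulrA [s1 x * (_ / _)]mulrC.
    have xr0 : r0 < x by exact: lt_trans lx.
    have x0 : 0 < x by exact: lt_trans xr0.
    rewrite mulr_le0_ge0 ?exprn_ge0//; last exact: ltW.
    have := s2le x xr0; have : 0 < c * s x ^+ 3 by rewrite mulr_gt0 ?exprn_gt0 ?s_gt0.
    lra.
  have : s1 r1 * r1 ^+ n < 0 by rewrite pmulr_llt0// exprn_gt0.
  move=> h1 h2; have := le_lt_trans h2 h1.
  by rewrite pmulr_llt0// exprn_gt0.
(* Since s1 < 0, the friction coefficient n may be raised to 2. *)
have s2le2 r : r1 <= r -> s2 r <= - (2 / r * s1 r) - c * s r ^+ 3.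
  move=> r1r; have r_gt0 : 0 < r by exact: lt_le_trans r1r.
  apply: le_trans (s2le r (lt_le_trans r1r0 r1r)) _.
  rewrite lerD2r lerN2; apply: ler_wnM2r; first by rewrite ltW// s1_lt0.
  by rewrite ler_pM2r ?invr_gt0// ler_nat.
pose S r := r * s r; pose S1 r := s r + r * s1 r.
pose S2 r := s1 r + s1 r + r * s2 r.
have DS r : r1 <= r -> has_deriv S r (S1 r).
  move=> r1r; have D := Ds r (lt_le_trans r1r0 r1r).
  by rewrite /S; differentiate; rewrite mul1r.
have DS1 r : r1 <= r -> has_deriv S1 r (S2 r).
  move=> r1r; have D := Ds r (lt_le_trans r1r0 r1r).
  have D1 := Ds1 r (lt_le_trans r1r0 r1r).
  by rewrite /S1; differentiate; rewrite mul1r addrA.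
have S_gt0 r : r1 <= r -> 0 < S r.
  move=> r1r; rewrite mulr_gt0 ?s_gt0//; first exact: lt_le_trans r1r.
  exact: lt_le_trans r1r.
have S2le r : r1 <= r -> r * S2 r <= - (c * S r ^+ 3 / r).
  move=> r1r; have r_gt0 : 0 < r by exact: lt_le_trans r1r.
  rewrite (_ : - (c * S r ^+ 3 / r) = r * (2 * s1 r
      + r * (- (2 / r * s1 r) - c * s r ^+ 3))); last first.
    by rewrite /S; field; rewrite gt_eqF.
  set t := - (2 / r * s1 r) - c * s r ^+ 3.
  have : r * s2 r <= r * t by rewrite ler_pM2l// s2le2.
  by move=> rt; rewrite ler_pM2l// /S2; lra.
exact: (@emden_fowler_no_positive c r1 S S1 S2).
Qed.

End Liouville.

(** * The radial equation and its signed solutions *)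

Section RadialODE.
Context {R : realType}.
Implicit Types (n : nat) (r M : R) (V w z : R -> R).

(** w'' + (n / r) w' + w V = 0, the equation - Delta w = w V for a radial
    profile in dimension n + 1. The derivatives exist on the whole line, since
    a profile extends to negative radii as an even function, while the singular
    equation is only required for r > 0. *)
Definition radial_solution n V w w1 w2 :=
  [/\ forall r, has_deriv w r (w1 r), forall r, has_deriv w1 r (w2 r)
    & forall r, 0 < r -> w2 r = - (n%:R / r * w1 r) - w r * V r].

Definition eventually_signed w :=
  exists2 r0 : R, 0 < r0 & (forall r, r0 < r -> 0 <= w r) \/
                       (forall r, r0 < r -> w r <= 0).

Lemma radial_solutionN n V w w1 w2 : radial_solution n V w w1 w2 ->
  radial_solution n V (fun r => - w r) (fun r => - w1 r) (fun r => - w2 r).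
Proof.
move=> [Dw Dw1 E]; split=> [r|r|r r0]; try exact: has_deriv_opp.
by rewrite E//; ring.
Qed.

(** Gronwall for the energy e = w^2 + w'^2. The friction term is dissipative,
    so that e' <= (1 + M) e suffices to the right of r0; to the left its size is
    at most (2 n / r) e, which the weight r^(2 n) absorbs. *)
Lemma radial_solution_unique n V w w1 w2 M (r0 : R) : radial_solution n V w w1 w2 ->
  (forall r, `|V r| <= M) -> 0 < r0 -> w r0 = 0 -> w1 r0 = 0 ->
  forall r, 0 <= r -> w r = 0.
Proof.
move=> [Dw Dw1 E] VM r00 w0 w10.
pose e r := w r ^+ 2 + w1 r ^+ 2.
pose de r := 2 * w r * w1 r + 2 * w1 r * w2 r.
have De r : has_deriv e r (de r).
  have D := Dw r; have D1 := Dw1 r.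
  by rewrite /e; differentiate; rewrite /de/=; ring.
have e_ge0 r : 0 <= e r by rewrite addr_ge0// sqr_ge0.
have e0 : e r0 = 0 by rewrite /e w0 w10 expr0n addr0.
have deE r : 0 < r -> de r = 2 * w r * w1 r * (1 - V r) - 2 * (n%:R / r * w1 r ^+ 2).
  by move=> r_gt0; rewrite /de E//; ring.
have cross r : `|2 * w r * w1 r * (1 - V r)| <= (1 + M) * e r.
  rewrite normrM mulrC; apply: ler_pM => //.
    by apply: le_trans (ler_normB _ _) _; rewrite normr1 lerD2l.
  rewrite ler_norml /e; have := sqr_ge0 (w r + w1 r); have := sqr_ge0 (w r - w1 r).
  by move=> ? ?; apply/andP; split; nra.
have fric r : 0 < r -> 0 <= n%:R / r * w1 r ^+ 2 <= n%:R / r * e r.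
  move=> r_gt0; have nr : 0 <= n%:R / r by rewrite divr_ge0// ltW.
  by rewrite mulr_ge0 ?sqr_ge0// ler_wpM2l// lerDr sqr_ge0.
have e_eq0 r : 0 < r -> e r = 0.
  move=> r_gt0; apply/eqP; rewrite eq_le e_ge0 andbT.
  have [rr0|rr0] := leP r r0.
    have : e r * (expR ((1 + M) * r) * r ^+ (2 * n)) <=
           e r0 * (expR ((1 + M) * r0) * r0 ^+ (2 * n)).
      apply: (@derive_ge0_le _ (fun x => e x * (expR ((1 + M) * x) * x ^+ (2 * n)))
        (fun x => (de x + (1 + M) * e x + 2 * (n%:R / x * e x))
                  * (expR ((1 + M) * x) * x ^+ (2 * n)))) => // x /andP[rx _].
        have x0 : 0 < x by exact: lt_le_trans rx.
        have D := De x; have Dx := @has_deriv_pow _ (2 * n) x x0.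
        apply: has_deriv_eq.
          apply: has_deriv_mul D _; apply: has_deriv_mul Dx.
          by derive_rules.
        by rewrite natrM /=; ring.
      have x0 : 0 < x by exact: lt_trans rx.
      rewrite mulr_ge0//; last by rewrite mulr_ge0 ?expR_ge0 ?exprn_ge0// ltW.
      have /andP[f1 f2] := fric x x0.
      have := cross x; rewrite ler_norml => /andP[c1 _].
      by rewrite deE//; set k := n%:R / x in f1 f2 *; lra.
    by rewrite e0 mul0r pmulr_lle0// mulr_gt0 ?expR_gt0 ?exprn_gt0.
  have : e r * expR (- (1 + M) * r) <= e r0 * expR (- (1 + M) * r0).
    apply: (@derive_le0_le _ (fun x => e x * expR (- (1 + M) * x))
      (fun x => (de x - (1 + M) * e x) * expR (- (1 + M) * x))) => //.
    - exact: ltW.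
    - by move=> x _; have D := De x; differentiate; ring.
    - move=> x /andP[r0x _]; have x0 : 0 < x by exact: lt_trans r0x.
      rewrite mulr_le0_ge0 ?expR_ge0//.
      have /andP[f1 f2] := fric x x0.
      have := cross x; rewrite ler_norml => /andP[_ c1].
      by rewrite deE//; set k := n%:R / x in f1 f2 *; lra.
  by rewrite e0 mul0r pmulr_lle0// expR_gt0.
have zero r : 0 < r -> w r = 0 /\ w1 r = 0.
  move=> /e_eq0/eqP; rewrite paddr_eq0 ?sqr_ge0// !sqrf_eq0.
  by move=> /andP[/eqP ? /eqP ?].
move=> r; rewrite le_eqVlt => /orP[/eqP <-|/zero[]//].
have [w_1 _] := zero 1 ltr01; rewrite -[RHS]w_1.
apply: (@derive_eq0_eq _ w w1) => // x /andP[x0 _].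
by have [] := zero x x0.
Qed.

(** A zero of a function of constant sign is a critical point, where uniqueness
    applies. The sign is kept as a factor e with e^2 = 1, which lets the cases
    of positive and of negative solutions be treated together. *)
Lemma eventually_pos_or_zero n V w w1 w2 M : radial_solution n V w w1 w2 ->
  (forall r, `|V r| <= M) -> eventually_signed w ->
  (forall r, 0 <= r -> w r = 0) \/
  exists e r0 : R, [/\ e ^+ 2 = 1, 0 < r0 & forall r, r0 < r -> 0 < e * w r].
Proof.
move=> sol VM [r0 r0_gt0 sgn].
wlog w_ge0 : w w1 w2 sol {sgn} / forall r, r0 < r -> 0 <= w r.
  move=> H; case: sgn => [|w_le0]; first exact: H sol.
  have [r r_gt0|z|[e [r1 [e1 r1_gt0 ew]]]] := H _ _ _ (radial_solutionN sol).
  - by rewrite oppr_ge0 w_le0.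
  - by left=> r /z /eqP; rewrite oppr_eq0 => /eqP.
  - right; exists (- e), r1; split=> //; first by rewrite sqrrN.
    by move=> r /ew; rewrite mulrN mulNr.
have [[r r0r wr]|npos] := pselect (exists2 r, r0 < r & w r = 0); last first.
  right; exists 1, r0; split=> //; first by rewrite expr1n.
  move=> r r0r; rewrite mul1r lt_neqAle w_ge0// andbT.
  by apply/eqP => wr; apply: npos; exists r.
left; have [Dw _ _] := sol.
have [r_d w10] : is_derive r 1 w 0.
  apply: (@derive1_at_min _ w r0 (r + 1)) => //.
  - by lra.
  - by move=> x _; case: (Dw x).
  - by rewrite in_itv/= r0r; lra.
  - by move=> x; rewrite in_itv/= wr => /andP[r0x _]; exact: w_ge0.
apply: (radial_solution_unique sol VM) wr _; first exact: lt_trans r0r.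
by case: (Dw r) => _ <-.
Qed.

End RadialODE.

(** * The coupled system and the cubic scalar equation *)

Section RadialSystem.
Context {R : realType}.
Implicit Types (n : nat) (r M a b : R) (w z : R -> R).

(** With q = (w'/w + z'/z) / 2 the logarithmic derivative of the geometric mean
    s = sqrt |w z|, one has s'' = s (q^2 + q'), in which the squares of w'/w and
    z'/z combine to - (w'/w - z'/z)^2 / 4 <= 0. The potentials contribute
    - (w^2 + z^2) / 2 <= - s^2, since a + b = 1. *)
Lemma no_signed_pair n a b w w1 w2 z z1 z2 (e f r0 : R) :
  (n <= 2)%N -> a + b = 1 ->
  radial_solution n (fun r => a * w r ^+ 2 + b * z r ^+ 2) w w1 w2 ->
  radial_solution n (fun r => a * z r ^+ 2 + b * w r ^+ 2) z z1 z2 ->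
  e ^+ 2 = 1 -> f ^+ 2 = 1 -> 0 < r0 ->
  (forall r, r0 < r -> 0 < e * w r) -> (forall r, r0 < r -> 0 < f * z r) ->
  False.
Proof.
move=> n2 ab [Dw Dw1 Ew] [Dz Dz1 Ez] e1 f1 r00 w_gt0 z_gt0.
pose p r := (e * w r) * (f * z r).
have p_gt0 r : r0 < r -> 0 < p r by move=> r0r; rewrite mulr_gt0 ?w_gt0 ?z_gt0.
pose q r := (w1 r / w r + z1 r / z r) / 2.
pose dq r := (w2 r / w r - (w1 r / w r) ^+ 2 + (z2 r / z r - (z1 r / z r) ^+ 2)) / 2.
pose s r := Num.sqrt (p r).
have w_neq0 r : r0 < r -> w r != 0.
  by move/w_gt0/lt0r_neq0; rewrite mulf_eq0 negb_or => /andP[].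
have z_neq0 r : r0 < r -> z r != 0.
  by move/z_gt0/lt0r_neq0; rewrite mulf_eq0 negb_or => /andP[].
have s_gt0 r : r0 < r -> 0 < s r by move=> r0r; rewrite sqrtr_gt0 p_gt0.
have sqs r : r0 < r -> s r ^+ 2 = p r
  by move=> r0r; rewrite sqr_sqrtr// ltW// p_gt0.
have Ds r : r0 < r -> has_deriv s r (s r * q r).
  move=> r0r; have D := Dw r; have D' := Dz r.
  rewrite /s /p; differentiate; first exact: p_gt0.
  have s0 := lt0r_neq0 (s_gt0 r r0r).
  rewrite -/(p r) -/(s r); apply: (mulfI s0).
  transitivity (p r * q r); last by rewrite -sqs//; ring.
  rewrite /q /p; field.
  by rewrite s0 w_neq0// z_neq0.
have Dq r : r0 < r -> has_deriv q r (dq r).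
  move=> r0r; have D := Dw r; have D' := Dz r; have D1 := Dw1 r; have D1' := Dz1 r.
  have w0 := w_neq0 r r0r; have z0 := z_neq0 r r0r.
  rewrite /q; differentiate => //.
  by rewrite /dq; field; rewrite w0 z0.
apply: (@exterior_liouville _ n 1 r0 s (fun r => s r * q r)
  (fun r => s r * q r * q r + s r * dq r)) => // r r0r.
  by apply: has_deriv_mul; [exact: Ds | exact: Dq].
have r_gt0 : 0 < r by exact: lt_trans r0r.
have w0 := w_neq0 r r0r; have z0 := z_neq0 r r0r.
rewrite mul1r (_ : _ - s r ^+ 3 = s r * (- (n%:R / r * q r) - p r)); last first.
  by rewrite -sqs//; ring.
rewrite -mulrA -mulrDr ler_pM2l ?s_gt0// /dq /q Ew// Ez//.
move: (n%:R / r : R) => k.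
rewrite (_ : (- (k * w1 r) - w r * _) / w r =
  - k * (w1 r / w r) - (a * w r ^+ 2 + b * z r ^+ 2)); last by field.
rewrite (_ : (- (k * z1 r) - z r * _) / z r =
  - k * (z1 r / z r) - (a * z r ^+ 2 + b * w r ^+ 2)); last by field.
have pE : p r = e * w r * (f * z r) by [].
have := sqr_ge0 (e * w r - f * z r); rewrite sqrrB !exprMn e1 f1 -pE.
have := sqr_ge0 (w1 r / w r - z1 r / z r).
have -> : b = 1 - a by rewrite -ab addrC addKr.
move: (w1 r / w r) (z1 r / z r) (p r) (w r) (z r) => A B P x y; nra.
Qed.

Lemma cubic_pos_zero n a w w1 w2 M : (n <= 2)%N -> 0 < a ->
  radial_solution n (fun r => a * w r ^+ 2) w w1 w2 ->
  (forall r, `|w r| <= M) -> eventually_signed w ->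
  forall r, 0 <= r -> w r = 0.
Proof.
move=> n2 a0 sol wM sgn.
have aM r : `|a * w r ^+ 2| <= a * M ^+ 2.
  have M0 : 0 <= M by exact: le_trans (wM 0).
  by rewrite normrM (gtr0_norm a0) ler_pM2l// normrX lerXn2r.
have [//|[e [r0 [e1 r00 ew]]]] := eventually_pos_or_zero sol aM sgn.
exfalso; have [Dw Dw1 Ew] := sol.
apply: (@exterior_liouville _ n a r0 (fun r => e * w r) (fun r => e * w1 r)
  (fun r => e * w2 r)) => //.
- by move=> r _; have D := Dw r; differentiate; ring.
- by move=> r _; have D := Dw1 r; differentiate; ring.
- move=> r r0r; have r_gt0 : 0 < r by exact: lt_trans r0r.
  rewrite Ew// (_ : (e * w r) ^+ 3 = e * w r ^+ 3); last first.
    by rewrite exprMn exprS e1 mulr1.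
  by rewrite le_eqVlt; apply/orP; left; apply/eqP; ring.
Qed.

(** r^n w' is constant and vanishes at r = 0. *)
Lemma cubic_zero_const n w w1 w2 : (0 < n)%N ->
  radial_solution n (fun _ => 0) w w1 w2 ->
  forall r, 0 <= r -> w r = w 0.
Proof.
move=> n0 [Dw Dw1 Ew].
have w1_0 r : 0 < r -> w1 r = 0.
  move=> r0; have : w1 0 * 0 ^+ n = w1 r * r ^+ n.
    apply: (@derive_eq0_eq _ (fun x => w1 x * x ^+ n)
      (fun x => w2 x * x ^+ n + w1 x * (n%:R * x ^+ n.-1))) => //.
    - exact: ltW.
    - by move=> x _; have D := Dw1 x; differentiate; rewrite mulr1.
    - move=> x /andP[x0 _]; rewrite Ew// mulr0 subr0.
      rewrite (_ : x ^+ n = x * x ^+ n.-1); last by rewrite -exprS prednK.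
      by field; rewrite gt_eqF.
  rewrite expr0n eqn0Ngt n0 mulr0 => /esym/eqP; rewrite mulf_eq0 expf_eq0 n0/=.
  by rewrite (gt_eqF r0) orbF => /eqP.
move=> r r0; symmetry; apply: (@derive_eq0_eq _ w w1) => // x /andP[x0 _].
exact: w1_0.
Qed.

(** (r^n w w')' = r^n (w'^2 - a w^4) >= 0 with r^n w w' = 0 at r = 0, so that
    w^2 is nondecreasing. If w is nonzero at some radius r0, the term - a w^4 is
    bounded below from there on, w w' grows at least linearly, and w^2 is
    unbounded. *)
Lemma cubic_neg_zero n a w w1 w2 M : (0 < n)%N -> a < 0 ->
  radial_solution n (fun r => a * w r ^+ 2) w w1 w2 ->
  (forall r, `|w r| <= M) -> forall r, 0 <= r -> w r = 0.
Proof.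
move=> n0 a0 [Dw Dw1 Ew] wM.
pose dh x := (w1 x * w1 x + w x * w2 x) * x ^+ n
             + w x * w1 x * (n%:R * x ^+ n.-1).
have Dh x : has_deriv (fun x => w x * w1 x * x ^+ n) x (dh x).
  by have D := Dw x; have D1 := Dw1 x; differentiate; rewrite mulr1.
have dhE x : 0 < x -> dh x = (w1 x ^+ 2 - a * w x ^+ 4) * x ^+ n.
  move=> x0; rewrite /dh Ew//.
  rewrite (_ : x ^+ n = x * x ^+ n.-1); last by rewrite -exprS prednK.
  by field; rewrite gt_eqF.
have dh_ge x : 0 < x -> - a * w x ^+ 4 * x ^+ n <= dh x.
  by move=> x0; rewrite dhE// ler_pM2r ?exprn_gt0// mulNr lerDr sqr_ge0.
have dh_ge0 x : 0 < x -> 0 <= dh x.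
  move=> x0; apply: le_trans (dh_ge x x0).
  apply: mulr_ge0; last by rewrite exprn_ge0// ltW.
  by apply: mulr_ge0; rewrite ?exprn_even_ge0// oppr_ge0 ltW.
have ww1_ge0 r : 0 < r -> 0 <= w r * w1 r.
  move=> r0; have := @derive_ge0_le _ (fun x => w x * w1 x * x ^+ n) dh 0 r.
  rewrite expr0n eqn0Ngt n0 mulr0 pmulr_lge0 ?exprn_gt0//; apply; first exact: ltW.
  - by move=> x _; exact: Dh.
  - by move=> x /andP[x0 _]; exact: dh_ge0.
have Dsq x : has_deriv (fun x => w x ^+ 2) x (2 * (w x * w1 x)).
  by have D := Dw x; differentiate => /=; ring.
have sq_nd x y : 0 <= x -> x <= y -> w x ^+ 2 <= w y ^+ 2.
  move=> x0 xy; apply: (@derive_ge0_le _ (fun x => w x ^+ 2)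
    (fun x => 2 * (w x * w1 x))) => // t /andP[xt _].
  by rewrite mulr_ge0// ww1_ge0// (le_lt_trans x0).
move=> r r0; apply/eqP; apply: contraT => wr0.
(* The divisor n + 1 is such that - a w(r)^4 y^n bounds the derivative of
   m (y - r) y^n from above. *)
pose m := - a * w r ^+ 4 / n.+1%:R.
have m0 : 0 < m.
  by rewrite divr_gt0// mulr_gt0 ?oppr_gt0// exprn_even_gt0.
have ww1_ge x : r < x -> m * (x - r) <= w x * w1 x.
  move=> rx; have x0 : 0 < x by exact: le_lt_trans rx.
  rewrite -(ler_pM2r (exprn_gt0 n x0)) -subr_ge0.
  apply: (@le_trans _ _ (w r * w1 r * r ^+ n - m * (r - r) * r ^+ n)).
    rewrite subrr mulr0 mul0r subr0.
    move: r0; rewrite le_eqVlt => /orP[/eqP <-|r_gt0].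
      by rewrite expr0n eqn0Ngt n0 mulr0.
    by rewrite mulr_ge0 ?ww1_ge0// exprn_ge0// ltW.
  apply: (@derive_ge0_le _ (fun x => w x * w1 x * x ^+ n - m * (x - r) * x ^+ n)
    (fun x => dh x - (m * x ^+ n + m * (x - r) * (n%:R * x ^+ n.-1)))).
  - exact: ltW.
  - move=> y _; have D := Dh y.
    by apply: has_deriv_add; [exact: D | differentiate; ring].
  - move=> y /andP[ry _]; have y0 : 0 < y by exact: le_lt_trans ry.
    have w4 : w r ^+ 4 <= w y ^+ 4.
      have h := sq_nd r y r0 (ltW ry).
      by rewrite -[4%N]/(2 * 2)%N !exprM lerXn2r// nnegrE sqr_ge0.
    have := dh_ge y y0.
    have h1 : m * n.+1%:R * y ^+ n <= - a * w y ^+ 4 * y ^+ n.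
      rewrite ler_pM2r ?exprn_gt0// /m divfK ?pnatr_eq0//.
      by rewrite ler_pM2l// oppr_gt0.
    have h2 : m * (y - r) * (n%:R * y ^+ n.-1) <= m * n%:R * y ^+ n.
      rewrite (_ : y ^+ n = y * y ^+ n.-1); last by rewrite -exprS prednK.
      have : 0 <= m * n%:R * y ^+ n.-1.
        apply: mulr_ge0; last by apply: exprn_ge0; exact: ltW.
        by apply: mulr_ge0; [exact: ltW | exact: ler0n].
      nra.
    rewrite -natr1 in h1; lra.
have [||||x rx] := @log_drift _ (fun x => - w x ^+ 2) (fun x => - (2 * (w x * w1 x)))
   (r + 1) (2 * m) _ _ _ _ (- M ^+ 2).
- by rewrite ltr_wpDl.
- by rewrite mulr_gt0.
- by move=> x _; apply: has_deriv_opp; exact: Dsq.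
- move=> x rx; have rltx : r < x by apply: lt_le_trans rx; rewrite ltrDl.
  have x1 : 1 <= x by apply: le_trans rx; rewrite lerDr.
  rewrite lerN2 -mulrA ler_pM2l//; apply: le_trans (ww1_ge x rltx).
  rewrite ler_pM2l//; apply: (@le_trans _ _ 1).
    by rewrite invf_le1// (lt_le_trans ltr01).
  lra.
- rewrite ltrN2 ltNge -[w x ^+ 2]real_normK ?num_real// lerXn2r// nnegrE//.
  exact: le_trans (wM 0).
Qed.

End RadialSystem.

(** * Radial functions along a coordinate axis *)

Section Rays.
Context {R : realType}.

Lemma derive_along_line N (u : 'rV[R]_N -> R) (x v : 'rV[R]_N) (t : R) :
  derivable u (t *: v + x) v ->
  has_deriv (fun s : R => u (s *: v + x)) t ('D_v u (t *: v + x)).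
Proof.
move=> du.
have E : (fun h : R => h^-1 *: (((fun s : R => u (s *: v + x)) \o shift t) (h *: 1)
             - u (t *: v + x))) =
         (fun h : R => h^-1 *: ((u \o shift (t *: v + x)) (h *: v)
             - u (t *: v + x))).
  by apply/funext => h /=; rewrite [h *: 1]mulr1 scalerDl addrA.
by split; [rewrite /derivable E | rewrite /derive E].
Qed.

Lemma has_deriv_unique (f : R -> R) x a b :
  has_deriv f x a -> has_deriv f x b -> a = b.
Proof. by move=> [_ <-] [_ <-]. Qed.

Context {n : nat}.
Implicit Types (u : 'rV[R]_n.+1 -> R) (h r s : R).

Definition axis (i : 'I_n.+1) : 'rV[R]_n.+1 := delta_mx ord0 i.

Definition along u r : R := u (r *: axis ord0).

Lemma eucl_norm_plane (i : 'I_n.+1) h r : i != ord0 ->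
  eucl_norm (h *: axis i + r *: axis ord0) = Num.sqrt (h ^+ 2 + r ^+ 2).
Proof.
move=> i0; congr Num.sqrt; rewrite (bigD1 i)//= (bigD1 ord0)//=; last by rewrite eq_sym.
rewrite big1 => [|j /andP[ji j0]]; rewrite !mxE ?eqxx/=.
  by rewrite (negbTE i0) [ord0 == i]eq_sym (negbTE i0) !mulr0 !mulr1 !addr0 add0r.
by rewrite (negbTE ji) (negbTE j0) !mulr0 addr0 expr0n.
Qed.

Lemma eucl_norm_axis r : eucl_norm (r *: axis ord0) = `|r|.
Proof.
rewrite /eucl_norm big_ord_recl big1 => [|i _]; rewrite !mxE ?eqxx/=.
  by rewrite mulr1 addr0 sqrtr_sqr.
by rewrite mulr0 expr0n.
Qed.

Lemma radial_along u x : radial u -> u x = along u (eucl_norm x).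
Proof.
by move=> ru; apply: ru; rewrite eucl_norm_axis ger0_norm// sqrtr_ge0.
Qed.

Lemma has_deriv_along u r : partially_derivable u ->
  has_deriv (along u) r (along (partial ord0 u) r).
Proof.
move=> du; have := @derive_along_line _ u 0 (axis ord0) r.
rewrite addr0 => /(_ (du ord0 _)).
by rewrite (_ : (fun s => u _) = along u)//; apply/funext => s; rewrite addr0.
Qed.

(** Each of the n directions orthogonal to the ray contributes the radial
    derivative divided by r: along the line r e_0 + h e_i the function takes
    the values of its profile at rho(h) = sqrt (h^2 + r^2), whose second
    derivative at h = 0 is 1 / r while the first one vanishes. *)
Lemma laplacian_along u r : C2b u -> radial u -> 0 < r ->
  laplacian u (r *: axis ord0) =
  along (partial ord0 (partial ord0 u)) r + n%:R / r * along (partial ord0 u) r.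
Proof.
move=> [_ du _ ddu _] ru r0.
pose rho (h : R) := Num.sqrt (h ^+ 2 + r ^+ 2).
have rho2_gt0 h : 0 < h ^+ 2 + r ^+ 2 by rewrite ltr_wpDl ?sqr_ge0// exprn_gt0.
have rho_gt0 h : 0 < rho h by rewrite sqrtr_gt0.
have Drho h : has_deriv rho h (h / rho h).
  rewrite /rho; differentiate; first exact: rho2_gt0.
  by rewrite -/(rho h) /=; field; rewrite lt0r_neq0.
have Du := fun h => has_deriv_along h du.
have Ddu := fun h => has_deriv_along h (ddu ord0).
have tangential (i : 'I_n.+1) : i != ord0 ->
    partial i (partial i u) (r *: axis ord0) = along (partial ord0 u) r / r.
  move=> i0.
  have pu h : partial i u (h *: axis i + r *: axis ord0) =
              along (partial ord0 u) (rho h) * (h / rho h).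
    apply: (has_deriv_unique (derive_along_line (du i _))).
    rewrite (_ : (fun s => u _) = (fun s => along u (rho s))).
      exact: has_deriv_chain (Drho h) (Du (rho h)).
    by apply/funext => s; rewrite radial_along// eucl_norm_plane.
  have := @derive_along_line _ (partial i u) (r *: axis ord0) (axis i) 0.
  rewrite scale0r add0r => /(_ (ddu i i _)) D.
  apply: (has_deriv_unique D).
  rewrite (_ : (fun s => _) =
      (fun h => along (partial ord0 u) (rho h) * (h / rho h))); last first.
    by apply/funext => s; rewrite pu.
  have D1 := has_deriv_chain (Drho 0) (Ddu (rho 0)).
  have D2 := Drho 0.
  have rho0 : rho 0 = r by rewrite /rho expr0n add0r sqrtr_sqr gtr0_norm.
  differentiate; first by rewrite lt0r_neq0.
  by rewrite rho0; field; rewrite lt0r_neq0.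
rewrite /laplacian big_ord_recl; congr (_ + _).
rewrite (eq_bigr (fun=> along (partial ord0 u) r / r)) => [|i _]; last exact: tangential.
by rewrite sumr_const card_ord -mulr_natl; ring.
Qed.

Lemma radial_solution_along u V : C2b u -> radial u ->
  (forall x, - laplacian u x = u x * V x) ->
  radial_solution n (along V) (along u) (along (partial ord0 u))
    (along (partial ord0 (partial ord0 u))).
Proof.
move=> Cu ru Eu; have [_ du _ ddu _] := Cu.
split=> [r|r|r r0]; try exact: has_deriv_along.
have := laplacian_along Cu ru r0; have := Eu (r *: axis ord0).
rewrite -/(along u r) -/(along V r) => E1 E2.
by rewrite -E1 E2; move: (along _ r) (along _ r) => p q; ring.
Qed.

Lemma C2b_bounded u : C2b u -> exists M : R, forall x, `|u x| <= M.
Proof.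
move=> [[_ [M [_ uM]]] _ _ _ _]; exists (M + 1) => x.
by apply: uM => //; rewrite ltrDl.
Qed.

(** Beyond the last radius r_m of a maximal alternation, a sign opposite to that
    at r_m would give a longer one. The value at r_m can be zero only when
    m = 0; any positive radius where u is nonzero then replaces r_0. *)
Lemma finite_nodal_eventually_signed u : radial u -> finite_nodal_number u ->
  eventually_signed (along u).
Proof.
move=> ru; rewrite /finite_nodal_number /nodal_number.
case: pselect => [[m [[r [r0 rlt ralt]] mmax]] _|//].
have r_gt0 j : (j <= m)%N -> 0 < r j.
  elim: j => // j IH jm; apply: lt_trans (rlt j jm); apply: IH; exact: ltnW.
have next y : r m < y -> 0 <= along u (r m) * along u y.
  move=> ry; rewrite leNgt; apply/negP => neg.
  have : alternates u m.+1.
    exists (fun j => if (j <= m)%N then r j else y); split=> //.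
    - move=> j jm; rewrite -ltnS jm.
      case: ltnP => [|mj]; first exact: rlt.
      by have -> : j = m by apply/eqP; rewrite eqn_leq mj -ltnS jm.
    - move=> j jm; rewrite -ltnS jm; case: ltnP => [|mj]; first exact: ralt.
      have -> : j = m by apply/eqP; rewrite eqn_leq mj -ltnS jm.
      by move=> x z xr zy; rewrite (radial_along x ru) (radial_along z ru) xr zy.
  by move=> /mmax; rewrite ltnn.
have signed_from s : 0 < s -> along u s != 0 ->
    (forall y, s < y -> 0 <= along u s * along u y) -> eventually_signed (along u).
  move=> s0 us H; exists s => //.
  have [us_lt|us_gt|us0] := ltgtP (along u s) 0.
  - by right=> y /H; rewrite nmulr_rge0.
  - by left=> y /H; rewrite pmulr_rge0.
  - by rewrite us0 eqxx in us.
have [um0|] := eqVneq (along u (r m)) 0; last first.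
  by move=> um; apply: (signed_from (r m)) => //; exact: r_gt0.
have m0 : m = 0%N.
  case: m {next} mmax rlt ralt um0 r_gt0 => // m _ _ ralt um0 r_gt0.
  have := ralt m (ltnSn m) (r m *: axis ord0) (r m.+1 *: axis ord0).
  rewrite !eucl_norm_axis !gtr0_norm ?r_gt0// => /(_ erefl erefl).
  by rewrite -/(along u (r m.+1)) um0 mulr0 ltxx.
have [[s s0 us]|allz] := pselect (exists2 s, 0 < s & along u s != 0); last first.
  exists 1 => //; left=> y y1; rewrite le_eqVlt; apply/orP; left; rewrite eq_sym.
  apply: contrapT => /negP uy; apply: allz; exists y => //; exact: lt_trans y1.
apply: (signed_from s) => // y sy; rewrite leNgt; apply/negP => neg.
have /mmax : alternates u 1.
  exists (fun j => if j == 0%N then s else y); split=> // -[|]// _ x z /= xs zy.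
  by rewrite (radial_along x ru) (radial_along z ru) xs zy.
by rewrite m0.
Qed.

End Rays.

(** * From the elliptic system to the radial one *)

Section Reduction.
Context {R : realType}.
Implicit Types (n : nat) (r M a b : R).

Lemma quadratic_bound a b (w z : R -> R) M : (forall r, `|w r| <= M) ->
  (forall r, `|z r| <= M) ->
  forall r, `|a * w r ^+ 2 + b * z r ^+ 2| <= (`|a| + `|b|) * M ^+ 2.
Proof.
move=> wM zM r; have M0 : 0 <= M by exact: le_trans (wM 0).
apply: le_trans (ler_normD _ _) _; rewrite mulrDl (normrM a) (normrM b) !normrX.
by apply: lerD; apply: ler_wpM2l => //; rewrite lerXn2r.
Qed.

Lemma one_component_vanishes n a b (w w1 w2 z z1 z2 : R -> R) M :
  (n <= 2)%N -> a + b = 1 ->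
  radial_solution n (fun r => a * w r ^+ 2 + b * z r ^+ 2) w w1 w2 ->
  radial_solution n (fun r => a * z r ^+ 2 + b * w r ^+ 2) z z1 z2 ->
  (forall r, `|w r| <= M) -> (forall r, `|z r| <= M) ->
  eventually_signed w -> eventually_signed z ->
  (forall r, 0 <= r -> w r = 0) \/ (forall r, 0 <= r -> z r = 0).
Proof.
move=> n2 ab sw sz wM zM sgw sgz.
have [|[e [r0 [e1 r00 ew]]]] :=
  eventually_pos_or_zero sw (quadratic_bound a b wM zM) sgw; first by left.
have [|[f [r1 [f1 r10 fz]]]] :=
  eventually_pos_or_zero sz (quadratic_bound a b zM wM) sgz; first by right.
exfalso; apply: (no_signed_pair (r0 := Num.max r0 r1) n2 ab sw sz e1 f1).
- by rewrite lt_max r00.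
- by move=> r; rewrite gt_max => /andP[/ew].
- by move=> r; rewrite gt_max => /andP[_ /fz].
Qed.

Lemma remaining_component n a b (w w1 w2 z : R -> R) M :
  (0 < n <= 2)%N ->
  radial_solution n (fun r => a * w r ^+ 2 + b * z r ^+ 2) w w1 w2 ->
  (forall r, `|w r| <= M) -> eventually_signed w ->
  (forall r, 0 <= r -> z r = 0) ->
  forall r, 0 <= r -> w r = if a == 0 then w 0 else 0.
Proof.
move=> /andP[n0 n2] [Dw Dw1 Ew] wM sgn z0.
have sol : radial_solution n (fun r => a * w r ^+ 2) w w1 w2.
  split=> // r r0; rewrite Ew// z0; first by ring.
  exact: ltW.
case: ifPn => [/eqP a0|].
  apply: (cubic_zero_const n0 (w1 := w1) (w2 := w2)).
  by case: sol => ? ? E; split=> // r /E ->; rewrite a0 mul0r.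
rewrite neq_lt => /orP[a0|a0].
- exact: cubic_neg_zero n0 a0 sol wM.
- exact: cubic_pos_zero n2 a0 sol wM sgn.
Qed.

(** This forms u + v and, applied to - v, also u - v. *)
Lemma radial_solution_sum n U V W (u u1 u2 v v1 v2 : R -> R) :
  radial_solution n U u u1 u2 -> radial_solution n V v v1 v2 ->
  (forall r, u r * U r + v r * V r = (u r + v r) * W r) ->
  radial_solution n W (fun r => u r + v r) (fun r => u1 r + v1 r)
    (fun r => u2 r + v2 r).
Proof.
move=> [Du Du1 Eu] [Dv Dv1 Ev] UVW; split=> [r|r|r r0]; try exact: has_deriv_add.
by rewrite Eu// Ev// -UVW; ring.
Qed.

Lemma solution_structure n (beta : R) (u v : 'rV[R]_n.+1 -> R) :
  (0 < n <= 2)%N -> solution beta u v ->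
  finite_nodal_number (fun x => u x + v x) ->
  finite_nodal_number (fun x => u x - v x) ->
  exists c : R, (beta <> -1 -> c = 0) /\
    ((forall x, u x = c /\ v x = - c) \/ (forall x, u x = c /\ v x = c)).
Proof.
move=> n12 [[Cu Cv] [ru rv] Eu Ev] nodal_sum nodal_diff.
have /andP[_ n2] := n12.
(* u^3 + v^3 + beta u v (u + v) = w (u^2 + v^2 + (beta - 1) u v), in which
   u^2 + v^2 = (w^2 + z^2) / 2 and u v = (w^2 - z^2) / 4; likewise for z. *)
pose a := (1 + beta) / 4; pose b := (3 - beta) / 4.
pose w r := along u r + along v r; pose z r := along u r - along v r.
have {}Eu x : - laplacian u x = u x * (u x ^+ 2 + beta * v x ^+ 2).
  by rewrite Eu; move: (u x) (v x) => p q; ring.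
have {}Ev x : - laplacian v x = v x * (v x ^+ 2 + beta * u x ^+ 2).
  by rewrite Ev; move: (u x) (v x) => p q; ring.
have su := radial_solution_along Cu ru Eu.
have sv := radial_solution_along Cv rv Ev.
have Ew r : along u r * (along u r ^+ 2 + beta * along v r ^+ 2)
    + along v r * (along v r ^+ 2 + beta * along u r ^+ 2)
    = w r * (a * w r ^+ 2 + b * z r ^+ 2).
  by rewrite /w /z /a /b; move: (along u r) (along v r) => p q; field.
have Ez r : along u r * (along u r ^+ 2 + beta * along v r ^+ 2)
    + - along v r * (along v r ^+ 2 + beta * along u r ^+ 2)
    = z r * (a * z r ^+ 2 + b * w r ^+ 2).
  by rewrite /w /z /a /b; move: (along u r) (along v r) => p q; field.
have sw := radial_solution_sum su sv Ew.
have sz := radial_solution_sum su (radial_solutionN sv) Ez.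
have [Mu uM] := C2b_bounded Cu; have [Mv vM] := C2b_bounded Cv.
have wM r : `|w r| <= Mu + Mv.
  exact: le_trans (ler_normD _ _) (lerD (uM _) (vM _)).
have zM r : `|z r| <= Mu + Mv.
  exact: le_trans (ler_normB _ _) (lerD (uM _) (vM _)).
have sgw : eventually_signed w.
  apply: (@finite_nodal_eventually_signed _ _ (fun x => u x + v x)) => // x y xy.
  by rewrite (ru _ _ xy) (rv _ _ xy).
have sgz : eventually_signed z.
  apply: (@finite_nodal_eventually_signed _ _ (fun x => u x - v x)) => // x y xy.
  by rewrite (ru _ _ xy) (rv _ _ xy).
have ab : a + b = 1 by rewrite /a /b; field.
have aE : beta <> -1 -> (a == 0) = false.
  by move=> bN; apply/eqP => a0; apply: bN; move: a0; rewrite /a; lra.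
have uE x : u x = (w (eucl_norm x) + z (eucl_norm x)) / 2.
  rewrite /w /z (radial_along x ru).
  by move: (along u _) (along v _) => p q; field.
have vE x : v x = (w (eucl_norm x) - z (eucl_norm x)) / 2.
  rewrite /w /z (radial_along x rv).
  by move: (along u _) (along v _) => p q; field.
have norm_ge0 (x : 'rV[R]_n.+1) : 0 <= eucl_norm x by exact: sqrtr_ge0.
have [w0|z0] := one_component_vanishes n2 ab sw sz wM zM sgw sgz.
- have zE := remaining_component n12 sz zM sgz w0.
  exists ((if a == 0 then z 0 else 0) / 2); split.
    by move=> /aE ->; rewrite mul0r.
  by left=> x; rewrite uE vE w0// (zE _ (norm_ge0 x)) add0r sub0r mulNr.
- have wE := remaining_component n12 sw wM sgw z0.
  exists ((if a == 0 then w 0 else 0) / 2); split.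
    by move=> /aE ->; rewrite mul0r.
  by right=> x; rewrite uE vE z0// (wE _ (norm_ge0 x)) addr0 subr0.
Qed.

End Reduction.

Theorem theorem1p5 (R : realType) (N : nat) (hN : N = 2%N \/ N = 3%N)
    (beta : R) :
  (beta <> -1 ->
     ~ exists u v : 'rV[R]_N -> R,
         [/\ solution beta u v,
             finite_nodal_number (fun x => u x + v x),
             finite_nodal_number (fun x => u x - v x)
           & ~ ((forall x, u x = 0) /\ (forall x, v x = 0))]) /\
  (beta = -1 ->
     forall u v : 'rV[R]_N -> R,
       solution beta u v ->
       finite_nodal_number (fun x => u x + v x) ->
       finite_nodal_number (fun x => u x - v x) ->
       exists c : R,
         (forall x, u x = c) /\
         ((forall x, v x = - c) \/ (forall x, v x = c))).
Proof.
have [n -> n12] : exists2 n, N = n.+1 & (0 < n <= 2)%N.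
  by case: hN => ->; [exists 1%N | exists 2%N].
split=> [bN [u [v [sol ns nd]]]|_ u v sol ns nd].
- have [c [/(_ bN) c0 H]] := solution_structure n12 sol ns nd; apply.
  by case: H => H; split=> x; case: (H x) => uc vc; rewrite ?uc ?vc c0 ?oppr0.
- have [c [_ H]] := solution_structure n12 sol ns nd.
  exists c; case: H => H; (split; first by move=> x; case: (H x)).
  + by left=> x; case: (H x).
  + by right=> x; case: (H x).
Qed.
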